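(* Let $k \geq 1$ and let $n, j \geq 2$ be integers. Then $p^k(n,j) \leq p^k(n+1,j+1)$, with equality whenever $n < 2^k j$.
   Context: $p^k(n,j)$ denotes the number of partitions of $n$ into exactly $j$ parts, each part a positive $k$-th power (unordered); i.e., the number of ways to write $n$ as a sum of exactly $j$ positive $k$-th powers, up to order of summands. *)

(* Defs.v *)
From mathcomp Require Import all_boot.

Set Implicit Arguments.
Unset Strict Implicit.
Unset Printing Implicit Defensive.

Definition is_pos_kth_power (k x : nat) : bool :=
  [exists m : 'I_x.+1, (0 < m) && (x == m ^ k)].

(* The base m is bounded by x in the definition so that it is decidable;
   nothing is lost when 0 < k, since then m <= m ^ k. *)
Lemma is_pos_kth_powerP (k x : nat) : 0 < k ->
  reflect (exists2 m, 0 < m & x = m ^ k) (is_pos_kth_power k x).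
Proof.
move=> k_gt0; apply: (iffP existsP) => [[m /andP[m_gt0 /eqP xE]]|[m m_gt0 xE]].
  by exists m.
have ltmx : m < x.+1.
  by rewrite ltnS xE -{1}(expn1 m) leq_pexp2l.
by exists (Ordinal ltmx); rewrite m_gt0; apply/eqP.
Qed.

(* A partition is represented by the non-increasing sequence of its parts. *)
Definition is_kth_power_partition (k n j : nat) (s : seq nat) : bool :=
  [&& sorted geq s, all (is_pos_kth_power k) s, size s == j & sumn s == n].

(* Every part is at most n, so the partitions of n into j parts all occur among
   the j-tuples over 'I_n.+1; see kth_power_partition_enum. *)
Definition pk (k n j : nat) : nat :=
  #|[set t : j.-tuple 'I_n.+1 |
      is_kth_power_partition k n j [seq val i | i <- t]]|.

Lemma kth_power_partition_enum (k n j : nat) :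
  exists2 l : seq (seq nat), uniq l /\ size l = pk k n j
    & forall s, (s \in l) = is_kth_power_partition k n j s.
Proof.
pose A := [set t : j.-tuple 'I_n.+1 |
  is_kth_power_partition k n j [seq val i | i <- t]].
exists [seq [seq val i | i <- tval t] | t <- enum A].
  split; last by rewrite size_map -cardE.
  rewrite map_inj_uniq ?enum_uniq // => t u /(inj_map val_inj) tu.
  exact: val_inj.
move=> s; apply/mapP/idP => [[t]|sP].
  by rewrite mem_enum inE => tP ->.
have /and4P[_ _ /eqP sz /eqP sm] := sP.
have le_s x : x \in s -> x < n.+1.
  move=> xs; rewrite ltnS -sm sumnE.
  by rewrite (perm_big _ (perm_to_rem xs)) big_cons leq_addr.
have szt : size [seq inord x : 'I_n.+1 | x <- s] == j by rewrite size_map sz.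
have sE : s = [seq val i | i <- [seq inord x : 'I_n.+1 | x <- s]].
  rewrite -map_comp -[LHS]map_id; apply/eq_in_map => x xs /=.
  by rewrite inordK // le_s.
by exists (Tuple szt) => //; rewrite mem_enum inE /= -sE.
Qed.

(* Main.v *)
Require Import Defs.
From mathcomp Require Import all_boot.

(** Appending a part 1 embeds the partitions of [n] into [j] parts into those of
    [n + 1] into [j + 1] parts, and its image consists of the partitions having a
    part 1.  A partition of [n + 1] without a part 1 has all its parts at least
    [2 ^ k], so [n + 1 >= 2 ^ k * (j + 1)], which is impossible when
    [n < 2 ^ k * j]. *)

(** Positive [k]-th powers are at least 1, so a final 1 never breaks the non-increasing order. *)
Lemma kth_power_partition_rcons1 (k n j : nat) (s : seq nat) : 0 < k ->
  is_kth_power_partition k n.+1 j.+1 (rcons s 1) =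
  is_kth_power_partition k n j s.
Proof.
move=> k_gt0; have pos1 : is_pos_kth_power k 1.
  by apply/is_pos_kth_powerP => //; exists 1; rewrite ?exp1n.
have geq_trans : transitive geq by move=> a b c /= ba cb; apply: leq_trans ba.
rewrite /is_kth_power_partition size_rcons sumn_rcons addn1 !eqSS all_rcons pos1 /=.
rewrite !(sorted_pairwise geq_trans) pairwise_rcons.
case: (boolP (all (is_pos_kth_power k) s)) => [/allP pos_s|_]; last by rewrite !andbF.
suff -> : all (geq^~ 1) s by [].
apply/allP => x /pos_s /(is_pos_kth_powerP _ k_gt0) [m m_gt0 ->].
by rewrite /= expn_gt0 m_gt0.
Qed.

Lemma sumn_ge_size (c : nat) (s : seq nat) :
  all (leq c) s -> c * size s <= sumn s.
Proof.
by elim: s => [|x s IHs] /=; rewrite ?muln0 // mulnS => /andP[cx /IHs]; apply: leq_add.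
Qed.

Lemma kth_power_partition_last1 (k n j : nat) (s : seq nat) :
    0 < k -> n < 2 ^ k * j -> is_kth_power_partition k n.+1 j.+1 s ->
  exists s', s = rcons s' 1.
Proof.
move=> k_gt0 lt_n; case/lastP: s => [|s x] /and4P[//].
have geq_trans : transitive geq by move=> a b c /= ba cb; apply: leq_trans ba.
rewrite (sorted_pairwise geq_trans) pairwise_rcons all_rcons.
move=> /andP[/allP ge_x _] /andP[/(is_pos_kth_powerP _ k_gt0) [m m_gt0 xE] _].
move=> /eqP sz /eqP sm.
(* The last part [x = m ^ k] is the smallest one, so its base decides: [m > 1] would force every
   part up to [2 ^ k]. *)
have [m_gt1|m_le1] := ltnP 1 m; last first.
  have m1 : m = 1 by apply/eqP; rewrite eqn_leq m_le1.
  by exists s; rewrite xE m1 exp1n.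
have le_x : 2 ^ k <= x by rewrite xE leq_exp2r.
have : all (leq (2 ^ k)) (rcons s x).
  by rewrite all_rcons le_x; apply/allP => y /ge_x /=; apply: leq_trans.
move=> /sumn_ge_size; rewrite sz sm mulnS leqNgt.
(* Adding [1 <= 2 ^ k] to [n < 2 ^ k * j] contradicts the lower bound on the sum. *)
by rewrite -add1n leq_add ?expn_gt0.
Qed.

Theorem theorem2p2 (k n j : nat) (hk : 1 <= k) (hn : 2 <= n) (hj : 2 <= j) :
  pk k n j <= pk k n.+1 j.+1 /\
  (n < 2 ^ k * j -> pk k n j = pk k n.+1 j.+1).
Proof.
have [l [l_uniq <-] lP] := kth_power_partition_enum k n j.
have [l' [l'_uniq <-] l'P] := kth_power_partition_enum k n.+1 j.+1.
(* With [l] replaced by its image, both lists hold partitions of [n.+1], and inclusions between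
   duplicate-free lists compare their sizes. *)
rewrite -(size_map (rcons^~ 1) l).
have map_uniq : uniq (map (rcons^~ 1) l).
  by rewrite map_inj_uniq //; apply: rcons_injl.
have sub : {subset map (rcons^~ 1) l <= l'}.
  by move=> _ /mapP[s + ->]; rewrite lP l'P kth_power_partition_rcons1.
have le_size := uniq_leq_size map_uniq sub; split=> // lt_n.
apply/eqP; rewrite eqn_leq le_size; apply: uniq_leq_size => // s; rewrite l'P => sP.
have [s' sE] := kth_power_partition_last1 _ _ _ _ hk lt_n sP.
by apply/mapP; exists s'; rewrite // lP -(kth_power_partition_rcons1 _ _ _ _ hk) -sE.
Qed.
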